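(* Let $F(X)\in\mathbb{Z}[X]$ be a nice polynomial (with the standing assumptions below), let $G(x)=x$, and let $k$ be a positive integer. Then: (1) The asymptotic density of $\mathscr{B}_{F,G,k}$ exists and equals $\displaystyle\sum_{d\ge1,\ (d,k)=1}\frac{\mu(d)}{\ell(dk)}$. (2) The asymptotic density of $\mathscr{A}_{F,G,k}$ exists and equals $\displaystyle\sum_{t=1}^{\infty}\frac{\mu(t)}{\ell(tk)}$. Here $\mu$ is the Möbius function.
   Context: Standing assumptions: $F(X)\in\mathbb{Z}[X]$ has positive leading coefficient and degree $d\ge 2$. Define $a_0=0$ and $a_n=F(a_{n-1})$ for $n\ge1$; it is assumed that the sequence $(a_n)$ is unbounded ($0$ is a wandering point). For a positive integer $n$, the rank of apparition is $\mathfrak{o}(n)=\min\{r\ge1: n\mid a_r\}$ if such $r$ exists and $\mathfrak{o}(n)=\infty$ otherwise; $\ell(n)=\mathrm{lcm}(n,\mathfrak{o}(n))$ if $\mathfrak{o}(n)<\infty$ and $\ell(n)=\infty$ otherwise (terms with $\ell=\infty$ contribute $0$ to the sums, i.e. $1/\infty=0$). For $G\in\mathbb{Z}[x]$ and a positive integer $k$, $\mathscr{B}_{F,G,k}$ is the set of positive integers $n$ such that $k\mid\gcd(G(n),a_n)$ and every prime dividing $\gcd(G(n),a_n)$ divides $k$; $\mathscr{A}_{F,G,k}=\{n\ge1:\gcd(G(n),a_n)=k\}$. $F$ is nice if $\sum_{p\text{ prime},\,p\mid a_p}1/p<\infty$. The asymptotic density of $\mathcal S\subseteq\mathbb{Z}_{>0}$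 is $\lim_{x\to\infty}\#(\mathcal S\cap[1,x])/x$ when it exists. *)

(* Defs.v *)
From HB Require Import structures.
From mathcomp Require Import all_boot all_order all_algebra.
From mathcomp Require Import all_classical all_reals all_analysis.

Set Implicit Arguments.
Unset Strict Implicit.
Unset Printing Implicit Defensive.

Import Order.TTheory GRing.Theory Num.Theory.
Import numFieldNormedType.Exports.
Local Open Scope classical_set_scope.
Local Open Scope ring_scope.

(* a_0 = 0, a_(n+1) = F(a_n) *)
Definition orbit0 (F : {poly int}) (n : nat) : int := iter n (horner F) 0.

Definition wandering0 (F : {poly int}) : Prop :=
  forall M : int, exists n : nat, M < `|orbit0 F n|.

(* Rank of apparition; [None] stands for infinity. *)
Definition rank (F : {poly int}) (n : nat) : option nat :=
  match pselect (exists r, (0 < r)%N && (n%:Z %| orbit0 F r)%Z) with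
  | left exr => Some (ex_minn exr)
  | right _ => None
  end.

Definition ell (F : {poly int}) (n : nat) : option nat :=
  omap (lcmn n) (rank F n).

(* Reciprocal, with 1 / infinity = 0 *)
Definition recip (R : realType) (m : option nat) : R :=
  if m is Some m' then m'%:R^-1 else 0.

(* The Moebius function, used at n > 0 only (the value at 0 is junk). *)
Definition moebius (n : nat) : int :=
  if all (fun p => logn p n == 1%N) (primes n)
  then (-1) ^+ size (primes n) else 0.

Definition nice (R : realType) (F : {poly int}) : Prop :=
  (\sum_(0 <= p <oo | prime p && (p%:Z %| orbit0 F p)%Z)
     (p%:R^-1 : R)%:E < +oo)%E.

Definition gcdGa (F G : {poly int}) (n : nat) : int :=
  gcdz G.[n%:Z] (orbit0 F n).

Definition setB (F G : {poly int}) (k : nat) : set nat :=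
  [set n | [/\ (0 < n)%N, (k%:Z %| gcdGa F G n)%Z &
     forall p : nat, prime p -> (p%:Z %| gcdGa F G n)%Z -> (p %| k)%N]].

Definition setA (F G : {poly int}) (k : nat) : set nat :=
  [set n | (0 < n)%N /\ gcdGa F G n = k%:Z].

(* [iota 1 (Num.truncn x)] lists the integers of [1, x], for real x >= 0. *)
Definition has_density (R : realType) (S : set nat) (delta : R) : Prop :=
  (count (mem S) (iota 1 (Num.truncn x)))%:R / x @[x --> +oo] --> delta.

(* Main.v *)
(* Since F is a polynomial, m | a_n iff rank(m) | n, hence tk | gcd(n, a_n) iff
   ell(tk) | n.  Everything rests on the convergence of sum_p 1/ell(p) over the
   primes.  The primes p | a_p contribute a convergent sum because F is nice.
   For the others rank(p) < p by the pigeonhole principle, so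
   ell(p) = p rank(p); there are at most (B+1)^r primes of rank <= r because
   they divide a_1 ... a_r, so rank(p) >> log p outside a sparse set, and
   sum 1/(p log p) converges by Chebyshev's bound.

   A tail of that sum bounds the error made by sifting only by small primes,
   which leaves a periodic set; so the density exists.

   The Moebius series need not converge absolutely.  To sum it in its natural
   order, take S to be the set under study and N an integer.  All t with
   ell(tk) <= N satisfy t <= N, so #(S cap [1, N]) is exactly the sum over
   t <= N of mu(t) floor(N / ell(tk)), and its distance to
   N sum_(t <= N) mu(t) / ell(tk) is at most
   sum_(t <= N) min(1, N / ell(t)).  This is o(N) because for each K the set of
   t with ell(t) <= K t has density 0: if ell(t) = c t then ell(p) | c t for
   every prime p | t, while almost all t have a prime factor beyond any bound. *)

Require Import Defs.
From HB Require Import structures.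
From mathcomp Require Import all_boot all_order all_algebra.
From mathcomp Require Import all_classical all_reals all_analysis.
From mathcomp Require Import zify ring lra.

Set Implicit Arguments.
Unset Strict Implicit.
Unset Printing Implicit Defensive.

Import Order.TTheory GRing.Theory Num.Theory.
Import numFieldNormedType.Exports.
Local Open Scope classical_set_scope.
Local Open Scope ring_scope.


(** * Elementary number theory *)

Lemma sum_multiples (V : nmodType) (p n : nat) (f : nat -> V) :
  (0 < p)%N ->
  \sum_(1 <= m < n.+1 | (p %| m)%N) f m = \sum_(1 <= i < (n %/ p).+1) f (i * p)%N.
Proof.
move=> p0; elim: n => [|n IHn]; first by rewrite div0n !big_geq.
rewrite big_mkcond big_nat_recr //= -big_mkcond IHn divnS //.
case: ifP => [pn|_]; last by rewrite add0n addr0.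
have E : (n.+1 = (n %/ p).+1 * p)%N by rewrite -[LHS](divnK pn) divnS// pn.
by rewrite add1n [RHS]big_nat_recr //= -E.
Qed.

Lemma moebius1 : moebius 1 = 1.
Proof. by []. Qed.

Lemma primes_mulp (p i : nat) :
  prime p -> (0 < i)%N -> ~~ (p %| i)%N -> perm_eq (primes (i * p)) (p :: primes i).
Proof.
move=> pp i0 pi; apply: uniq_perm; rewrite /= ?primes_uniq ?andbT//.
  by rewrite mem_primes pp i0.
move=> q; by rewrite primesM ?(prime_gt0 pp)// (primes_prime pp) !inE orbC.
Qed.

Lemma moebius_mulp (p i : nat) :
  prime p -> (0 < i)%N -> ~~ (p %| i)%N -> moebius (i * p) = - moebius i.
Proof.
move=> pp i0 pi; have Hp := primes_mulp pp i0 pi.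
rewrite /moebius (perm_all _ Hp) (perm_size Hp) /=.
have -> : logn p (i * p) = 1%N.
  rewrite lognM ?(prime_gt0 pp)// (logn_prime p pp) eqxx.
  by move: (pfactor_dvdn 1 pp i0); rewrite expn1 (negbTE pi); case: logn.
rewrite eqxx /=.
have -> : all (fun q => logn q (i * p) == 1%N) (primes i) =
    all (fun q => logn q i == 1%N) (primes i).
  apply: eq_in_all => q; rewrite mem_primes => /and3P[pq _ qi].
  rewrite lognM ?(prime_gt0 pp)// (logn_prime q pp).
  by case: (q =P p) => [qp|]; rewrite ?addn0//; rewrite qp (negbTE pi) in qi.
by case: ifP => _; rewrite ?oppr0// exprS mulN1r.
Qed.

Lemma moebius_mulp_dvd (p i : nat) :
  prime p -> (0 < i)%N -> (p %| i)%N -> moebius (i * p) = 0.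
Proof.
move=> pp i0 pi; rewrite /moebius ifN//; apply/allPn; exists p.
  by rewrite mem_primes pp muln_gt0 i0 prime_gt0//= dvdn_mull.
rewrite lognM ?(prime_gt0 pp)// (logn_prime p pp) eqxx.
by move: (pfactor_dvdn 1 pp i0); rewrite expn1 pi; case: logn => // l _; rewrite addn1.
Qed.

Lemma normr_moebius (n : nat) : `|moebius n| <= 1.
Proof. by rewrite /moebius; case: ifP => _; rewrite ?normr0// normrX normrN1 expr1n. Qed.

(** Fix a prime p | n. Divisors i prime to p cancel against i p, since mu(i p) = - mu(i), and mu
    vanishes on the multiples of p^2. *)
Lemma sum_moebius_dvd (n N : nat) : (0 < n <= N)%N ->
  \sum_(1 <= d < N.+1 | (d %| n)%N) moebius d = (n == 1%N)%:R.
Proof.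
case/andP => n0 nN; case: (eqVneq n 1%N) => [->|n1].
  rewrite big_ltn_cond ?ltnS ?(leq_trans n0 nN)//=.
  rewrite big_nat_cond big1 ?addr0 ?moebius1//.
  by move=> i /andP[/andP[i2 _]]; rewrite dvdn1 => /eqP i1; rewrite i1 in i2.
have n1' : (1 < n)%N by rewrite ltn_neqAle eq_sym n1.
have pp := pdiv_prime n1'; set p := pdiv n in pp *.
have pn : (p %| n)%N by apply: pdiv_dvd.
rewrite (bigID (fun d => (p %| d)%N)) /=.
under eq_bigl do rewrite andbC.
rewrite big_mkcondr sum_multiples ?prime_gt0//=.
have -> : \sum_(1 <= i < (N %/ p).+1)
    (if ((i * p)%N %| n)%N then moebius (i * p) else 0) =
    - \sum_(1 <= i < (N %/ p).+1 | (i %| n)%N && ~~ (p %| i)%N) moebius i.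
  rewrite -sumrN [RHS]big_mkcond [LHS]big_nat [RHS]big_nat.
  apply: eq_bigr => i /andP[i0 _].
  have [pi|pi] := boolP (p %| i)%N.
    by rewrite andbF moebius_mulp_dvd//; case: ifP.
  rewrite andbT moebius_mulp//; congr (if _ then _ else _).
  by rewrite Gauss_dvd ?pn ?andbT// coprime_sym prime_coprime.
apply/eqP; rewrite addrC subr_eq0; apply/eqP.
(* The sum coming from the multiples of p runs only to [N %/ p]. The other sum has no term beyond: a
   divisor i of n prime to p satisfies i p | n, so i p <= N. *)
rewrite (@big_cat_nat _ _ _ (N %/ p).+1)//=; last by rewrite ltnS leq_div.
rewrite [X in _ + X]big_nat_cond [X in _ + X]big1 ?addr0//.
move=> i /andP[/andP[iN _] /andP[din pi]].
have : (i * p <= N)%N.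
  apply: leq_trans nN; apply: dvdn_leq => //.
  by rewrite Gauss_dvd ?pn ?andbT// coprime_sym prime_coprime.
by rewrite -leq_divRL ?prime_gt0// leqNgt iN.
Qed.

Lemma prod_primes_dvd (s : seq nat) (m : nat) :
  uniq s -> all prime s -> all (fun p => (p %| m)%N) s -> (\prod_(p <- s) p %| m)%N.
Proof.
elim: s => [|p s IHs]; first by rewrite big_nil.
move=> /= /andP[ps us] /andP[pp aps] /andP[pm asm].
rewrite big_cons Gauss_dvd ?pm ?IHs//.
rewrite prime_coprime// Euclid_dvd_prod//; apply/negP ; rewrite big_has => /hasP[q qs].
by rewrite dvdn_prime2//= ?(allP aps)// => /eqP pq; rewrite pq qs in ps.
Qed.

(** Distinct primes dividing m have a product dividing m. This limits the number of primes both in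
    Chebyshev's estimate and among those of small rank. *)
Lemma expn_size_primes (b : nat) (s : seq nat) (m : nat) : (0 < m)%N ->
  uniq s -> all prime s -> all (leq b) s -> all (fun p => (p %| m)%N) s ->
  (b ^ size s <= m)%N.
Proof.
move=> m0 us ps bs ds; apply: leq_trans (dvdn_leq m0 (prod_primes_dvd us ps ds)).
elim: s bs {us ps ds} => [|p s IHs]; first by rewrite big_nil.
by move=> /= /andP[bp bs]; rewrite big_cons expnS leq_mul ?IHs.
Qed.

Lemma prime_dvd_fact (p n : nat) : prime p -> (p %| n`!)%N = (p <= n)%N.
Proof.
move=> pp; apply/idP/idP => [|pn]; last by rewrite dvdn_fact// prime_gt0.
by rewrite fact_prod Euclid_dvd_prod// big_has => /hasP[i]; rewrite mem_index_iota ltnS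
  => /andP[i0 iN] /(dvdn_leq i0) /leq_trans; apply.
Qed.

(* The primes of (2^j, 2^(j+1)] divide the binomial coefficient of 2^(j+1)
   over 2^j, which is at most 2^(2^(j+1)). *)
Lemma chebyshev_dyadic (j : nat) :
  (j * count prime (index_iota (2 ^ j).+1 (2 ^ j.+1).+1) <= 2 ^ j.+1)%N.
Proof.
rewrite -size_filter; set s := seq.filter _ _.
rewrite -(@leq_exp2l 2)// expnM.
have E : (2 ^ j.+1 = 2 ^ j + 2 ^ j)%N by rewrite expnS mul2n addnn.
apply: (@leq_trans 'C(2 ^ j.+1, 2 ^ j)); last first.
  have := expnDn 1 1 (2 ^ j.+1); rewrite addn1 => ->.
  have H : (2 ^ j < (2 ^ j.+1).+1)%N by rewrite ltnS leq_exp2l.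
  rewrite (bigD1 (Ordinal H))//= !exp1n !muln1; exact: leq_addr.
apply: expn_size_primes.
- by rewrite bin_gt0 leq_exp2l.
- by rewrite filter_uniq// iota_uniq.
- exact: filter_all.
- by apply/allP => p; rewrite mem_filter mem_index_iota => /and3P[_ /ltnW].
- apply/allP => p; rewrite mem_filter mem_index_iota ltnS => /and3P[pp pl pu].
  (* (2^(j+1))! is the binomial coefficient times the square of (2^j)!, and p > 2^j does not divide
     (2^j)!. *)
  have : (p %| (2 ^ j.+1)`!)%N by rewrite prime_dvd_fact.
  rewrite -(@bin_fact _ (2 ^ j)) ?leq_exp2l// [X in (X - _)%N]E addnK.
  by rewrite !Euclid_dvdM// !prime_dvd_fact// leqNgt pl /= !orbF.
Qed.



(** * Euler products and integers free of the primes of an interval *)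

(** Induction on z. When z is prime, the terms m = i z have i again smooth, so they add up to at
    most 1/z times the whole sum; the new factor 1 - 1/z absorbs them. *)
Lemma sum_smooth_euler (R : realType) (z n : nat) :
  (\sum_(1 <= m < n.+1 | all (fun p => p < z)%N (primes m)) m%:R^-1) *
    \prod_(0 <= p < z | prime p) (1 - p%:R^-1) <= 1 :> R.
Proof.
pose sm z m := all (fun p => p < z)%N (primes m).
pose S z : R := \sum_(1 <= m < n.+1 | sm z m) m%:R^-1.
have S0 z' : 0 <= S z' by apply: sumr_ge0.
rewrite -/(sm z) -/(S z); elim: z => [|z IHz].
  rewrite big_geq// mulr1 /S; have [->|n0] := posnP n; first by rewrite big_geq.
  rewrite big_mkcond big_ltn//= big_nat_cond big1 ?addr0 ?invr1//.
  move=> i /andP[/andP[i1 _] _]; rewrite ifF//; apply/negbTE/allPn.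
  by exists (pdiv i); rewrite // mem_primes pdiv_prime// pdiv_dvd ltnW.
have smS m : ~~ prime z || ~~ (z %| m)%N -> sm z.+1 m = sm z m.
  move=> H; apply: eq_in_all => p; rewrite mem_primes ltnS (leq_eqVlt p z).
  by move=> /and3P[pp _ pm]; case: (p =P z) => // pz; rewrite -pz pp pm in H.
rewrite big_mkcond big_nat_recr//= -big_mkcond/=.
case: ifP => [pz|/negbT npz]; last first.
  rewrite mulr1 (_ : S z.+1 = S z)//.
  by apply: eq_bigl => m; rewrite smS// npz.
have z0 : (0 < z)%N by rewrite prime_gt0.
rewrite mulrCA mulrC; apply: le_trans IHz; rewrite ler_wpM2r//.
  apply: prodr_ge0 => p pp.
  by rewrite subr_ge0 invf_le1 ?ler1n ?ltr0n ?prime_gt0.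
rewrite mulrBr mulr1 lerBlDr.
rewrite [leLHS](bigID (fun m => z %| m)%N)/= addrC lerD//.
  rewrite /S [leLHS]big_mkcond [leRHS]big_mkcond ler_sum//= => m _.
  have [zm|zm] := boolP (z %| m)%N; first by rewrite andbF; case: ifP.
  by rewrite andbT smS ?zm ?orbT.
under eq_bigl do rewrite andbC.
rewrite big_mkcondr sum_multiples//= mulr_suml.
rewrite [leRHS]big_mkcond [leRHS](@big_cat_nat _ _ _ (n %/ z).+1)//=; last first.
  by rewrite ltnS leq_div.
rewrite -[leLHS]addr0 lerD//; last first.
  by apply: sumr_ge0 => i _; case: ifP => // _; rewrite mulr_ge0.
rewrite big_nat [leRHS]big_nat ler_sum// => i /andP[i0 _].
case: ifP => smi; last by case: ifP.
rewrite ifT; first by rewrite natrM invfM.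
apply/allP => p; rewrite mem_primes => /and3P[pp _ pi].
by apply: (allP smi); rewrite mem_primes pp muln_gt0 i0 z0 dvdn_mulr.
Qed.

Lemma prod_euler_harmonic (R : realType) (n : nat) :
  (\sum_(1 <= m < n.+1) m%:R^-1) *
    \prod_(0 <= p < n.+1 | prime p) (1 - p%:R^-1) <= 1 :> R.
Proof.
apply: le_trans (sum_smooth_euler R n.+1 n).
rewrite ler_wpM2r//.
  apply: prodr_ge0 => p pp.
  by rewrite subr_ge0 invf_le1 ?ler1n ?ltr0n ?prime_gt0.
rewrite le_eqVlt; apply/orP; left; apply/eqP.
rewrite [RHS]big_mkcond [LHS]big_nat [RHS]big_nat; apply: eq_bigr => m /andP[m0 mn].
rewrite ifT//; apply/allP => p; rewrite mem_primes => /and3P[_ _ /dvdn_leq].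
by move=> /(_ m0) pm; apply: leq_ltn_trans pm mn.
Qed.

Lemma harmonic_unbounded (R : realType) (A : R) (y : nat) :
  exists2 n : nat, (y <= n)%N & A < \sum_(1 <= m < n.+1) m%:R^-1.
Proof.
suff [n An] : exists n : nat, A < \sum_(1 <= m < n.+1) m%:R^-1.
  exists (maxn n y); first exact: leq_maxr.
  apply: lt_le_trans An _; rewrite [leRHS](@big_cat_nat _ _ _ n.+1)//=.
    by rewrite lerDl sumr_ge0.
  by rewrite ltnS leq_maxl.
apply: contrapT => /forallNP H; apply: (@dvg_harmonic R).
apply: nondecreasing_is_cvgn.
  apply/nondecreasing_seqP => n; rewrite /series/= big_nat_recr//= lerDl.
  by rewrite invr_ge0.
exists A => _ [n _ <-]; have /negP := H n; rewrite -leNgt.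
by rewrite big_add1.
Qed.

Lemma totient_prod_primes (R : realType) (y z : nat) : (y <= z)%N ->
  (totient (\prod_(y <= p < z | prime p) p))%:R =
  (\prod_(y <= p < z | prime p) p)%:R *
    \prod_(y <= p < z | prime p) (1 - p%:R^-1) :> R.
Proof.
elim: z => [|z IHz] yz; first by rewrite !big_geq// mulr1.
move: yz; rewrite leq_eqVlt => /orP[/eqP ->|]; first by rewrite !big_geq// mulr1.
rewrite ltnS => yz; rewrite !(big_mkcond prime) !big_nat_recr//= -!big_mkcond/=.
case: ifP => [pz|_]; last by rewrite muln1 !mulr1 IHz.
rewrite totient_coprime; last first.
  rewrite coprime_sym prime_coprime// Euclid_dvd_prod// big_has_cond.
  apply/negP => /hasP[p]; rewrite mem_index_iota => /andP[_ pz'] /andP[pp].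
  by rewrite dvdn_prime2// => /eqP zp; rewrite zp ltnn in pz'.
rewrite (totient_prime pz) !natrM IHz// -subn1 natrB ?prime_gt0//.
have : z%:R != 0 :> R by rewrite pnatr_eq0 -lt0n prime_gt0.
set a := \prod_(y <= i < z | prime i) _; set b := (\prod_(y <= i < z | prime i) i)%:R.
by move=> ?; field.
Qed.

(** The product of 1 - 1/p over p <= n is at most the inverse of a harmonic sum, hence tends to 0.
    The primes below y contribute a fixed positive factor, which is divided out. Thus few integers
    avoid all the primes of [y, z). *)
Lemma totient_prod_primes_small (R : realType) (y : nat) (eps : R) : 0 < eps ->
  exists z : nat, (totient (\prod_(y <= p < z | prime p) p))%:R <=
    eps * (\prod_(y <= p < z | prime p) p)%:R :> R.
Proof.
move=> e0; pose E (y z : nat) : R := \prod_(y <= p < z | prime p) (1 - p%:R^-1).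
have E_gt0 u v : 0 < E u v.
  apply: prodr_gt0 => p pp.
  by rewrite subr_gt0 invf_lt1 ?ltr1n ?ltr0n ?prime_gt0 ?prime_gt1.
have [n yn nE] := harmonic_unbounded (eps * E 0%N y)^-1 y.
exists n.+1; rewrite totient_prod_primes ?leqW// mulrC ler_wpM2r//.
have := prod_euler_harmonic R n.
rewrite (@big_cat_nat _ _ _ y _ _ prime)/= ?leqW// -/(E 0%N y) -/(E y n.+1) => H.
have e1 : 0 < eps * E 0%N y by rewrite mulr_gt0.
have : (eps * E 0%N y)^-1 * (E 0%N y * E y n.+1) <= 1.
  by apply: le_trans H; rewrite ler_wpM2r ?mulr_ge0// ltW.
by rewrite ler_pdivrMl// mulr1 mulrC ler_pM2r.
Qed.



(** * Counting in [1, N] *)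

Lemma count_iotaS (P : pred nat) (N : nat) :
  count P (iota 1 N.+1) = (count P (iota 1 N) + P N.+1)%N.
Proof. by rewrite -[N.+1]addn1 iotaD count_cat /= addn0 add1n addn1. Qed.

Lemma count_natr (R : pzSemiRingType) (P : pred nat) (N : nat) :
  (count P (iota 1 N))%:R = \sum_(1 <= n < N.+1) (P n)%:R :> R.
Proof.
elim: N => [|N IHN]; first by rewrite big_geq.
by rewrite count_iotaS natrD IHN [RHS]big_nat_recr.
Qed.

Lemma count_dvdn (d N : nat) : count (dvdn d) (iota 1 N) = (N %/ d)%N.
Proof.
rewrite divn_count_dvd; elim: N => [|N IHN]; first by rewrite big_geq.
by rewrite count_iotaS IHN [RHS]big_nat_recr.
Qed.

Lemma count_iota_le (P : pred nat) (N : nat) : (count P (iota 1 N) <= N)%N.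
Proof. by rewrite -[leqRHS](size_iota 1) count_size. Qed.

Lemma count_periodic (P : pred nat) (T q s : nat) :
  (forall n, P (T + n)%N = P n) ->
  count P (iota 1 (q * T + s)) =
    (q * count P (iota 1 T) + count P (iota 1 s))%N.
Proof.
move=> HP; elim: q => [|q IHq]; first by rewrite !mul0n.
rewrite mulSn -addnA iotaD count_cat (addnC 1%N) iotaDl count_map.
by rewrite (eq_count HP) IHq mulSn addnA.
Qed.

(** Complete periods contribute their exact share; only a remainder shorter than T is left to
    estimate. *)
Lemma periodic_density (R : realFieldType) (P : pred nat) (T N : nat) :
  (0 < T)%N -> (forall n, P (T + n)%N = P n) ->
  `|(count P (iota 1 N))%:R - N%:R * ((count P (iota 1 T))%:R / T%:R)| <= T%:R :> R.
Proof.
move=> T0 HP; rewrite [in X in count _ X](divn_eq N T) count_periodic//.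
set c := count P (iota 1 T); set s := (N %% T)%N; set q := (N %/ T)%N.
have cT : (c <= T)%N by exact: count_iota_le.
have sT : (s < T)%N by rewrite ltn_mod.
rewrite (_ : N%:R = q%:R * T%:R + s%:R :> R); last by rewrite -natrM -natrD -divn_eq.
rewrite natrD natrM.
have T0' : 0 < T%:R :> R by rewrite ltr0n.
rewrite (_ : _ - _ = (count P (iota 1 s))%:R - s%:R * (c%:R / T%:R)); last first.
  by field; rewrite gt_eqF.
have : s%:R <= T%:R :> R by rewrite ler_nat ltnW.
have : (count P (iota 1 s))%:R <= s%:R :> R by rewrite ler_nat count_iota_le.
have : c%:R / T%:R <= 1 :> R by rewrite ler_pdivrMr// mul1r ler_nat.
have : 0 <= c%:R / T%:R :> R by rewrite divr_ge0.
have : 0 <= (count P (iota 1 s))%:R :> R by [].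
have : 0 <= s%:R :> R by [].
set x := _ / _; set y := s%:R; set z := (count _ _)%:R; set w := T%:R.
by move=> *; rewrite ler_norml; apply/andP; split; nra.
Qed.

Lemma count_coprime (M : nat) : count (coprime M) (iota 1 M) = totient M.
Proof.
rewrite totient_count_coprime; case: M => [|M]; first by rewrite big_geq.
(* The totient counts over [0, M), the list covers [1, M]: the two ends are the same residue. *)
have E : coprime M.+1 0 = coprime M.+1 M.+1 by rewrite /coprime gcdn0 gcdnn.
rewrite big_ltn// E count_iotaS addnC; congr addn.
move: (coprime M.+1) => Q {E}; elim: M => [|m IHm]; first by rewrite big_geq.
by rewrite count_iotaS IHm [RHS]big_nat_recr.
Qed.

Lemma count_natr_le (R : realFieldType) (x : R) (N : nat) : 0 <= x ->
  (count (fun t => t%:R <= x) (iota 1 N))%:R <= x.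
Proof.
move=> x0; elim: N => [|N IHN] //; rewrite count_iotaS.
have [Nx|_] := boolP (N.+1%:R <= x); last by rewrite addn0.
by apply: le_trans Nx; rewrite ler_nat addn1 ltnS count_iota_le.
Qed.

(** Infinity divides nothing, so that for n > 0 the test on [ell F m] amounts to m | gcd(n, a_n). *)
Definition divides_opt (o : option nat) (n : nat) : bool :=
  if o is Some e then (e %| n)%N else false.

Lemma recip_ge0 (R : realType) (o : option nat) : 0 <= recip R o.
Proof. by case: o => [n|] /=. Qed.

(** The count is floor(N / e), so the defect is a fractional part. The bound 1 serves for small e,
    the bound N / e for large e. *)
Lemma count_divides_opt (R : realType) (o : option nat) (N : nat) :
  (if o is Some e then (0 < e)%N else true) ->
  0 <= N%:R * recip R o - (count (divides_opt o) (iota 1 N))%:R <=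
    Num.min 1 (N%:R * recip R o).
Proof.
case: o => [e|] e0; last first.
  by rewrite mulr0 (eq_count (a2 := pred0))// count_pred0 subr0 lexx le_min ler01 lexx.
rewrite /divides_opt count_dvdn /=.
have e0' : 0 < e%:R :> R by rewrite ltr0n.
rewrite subr_ge0 ler_pdivlMr// -natrM ler_nat leq_trunc_div /=.
rewrite le_min; apply/andP; split; last by rewrite gerBl.
rewrite lerBlDr ler_pdivrMr// nat1r -natrM ler_nat.
by rewrite ltnW// ltn_ceil.
Qed.



(** * Asymptotically linear counting functions *)

(** Equivalent to f(N) / N tending to delta; writing the error as eps N + B avoids thresholds and
    division by N. *)
Definition asymp_linear (R : realType) (f : nat -> R) (delta : R) : Prop :=
  forall eps, 0 < eps -> exists B, forall N, `|f N - N%:R * delta| <= eps * N%:R + B.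

Lemma linear_bound_le (R : realType) (a b B : R) :
  (forall N : nat, N%:R * a <= N%:R * b + B) -> a <= b.
Proof.
move=> H; rewrite leNgt; apply/negP => ba.
have ab : 0 < a - b by rewrite subr_gt0.
have H2 : forall N : nat, N%:R <= B / (a - b).
  by move=> N; rewrite ler_pdivlMr// mulrBr lerBlDl.
have := truncnS_gt (B / (a - b)); rewrite ltNge.
by rewrite H2.
Qed.

(** A Cauchy criterion: the intervals [d - eps, d + eps] given by approximate slopes d meet
    pairwise, so the supremum of their left ends lies in all of them. *)
Lemma asymp_linear_complete (R : realType) (f : nat -> R) :
  (forall eps, 0 < eps -> exists delta B,
     forall N, `|f N - N%:R * delta| <= eps * N%:R + B) ->
  exists delta, asymp_linear f delta.
Proof.
move=> H.
pose good eps d := exists B, forall N, `|f N - N%:R * d| <= eps * N%:R + B.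
have cmp e1 e2 d1 d2 : good e1 d1 -> good e2 d2 -> d1 - e1 <= d2 + e2.
  move=> [B1 H1] [B2 H2]; apply: (@linear_bound_le R _ _ (B1 + B2)) => N.
  have := H1 N; have := H2 N; rewrite !ler_norml => /andP[? ?] /andP[? ?]; nra.
pose A := [set x : R | exists e d, [/\ 0 < e, good e d & x = d - e]].
have ubA e d : 0 < e -> good e d -> ubound A (d + e).
  by move=> e0 g x [e' [d' [_ g' ->]]]; exact: cmp g' g.
have A0 : A !=set0.
  by have [d gd] := H 1 ltr01; exists (d - 1); exists 1, d.
have supA : has_sup A.
  split=> //; have [d gd] := H 1 ltr01; exists (d + 1); exact: ubA.
exists (sup A) => eps e0.
have e2 : 0 < eps / 2 by rewrite divr_gt0.
have [d gd] := H _ e2; have [B HB] := gd; exists B => N.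
have h1 : sup A <= d + eps / 2 by apply: ge_sup => //; exact: ubA.
have h2 : d - eps / 2 <= sup A by apply: ub_le_sup; [exact: supA.2|exists (eps / 2), d].
have N0 : 0 <= N%:R :> R by [].
move: (HB N) N0 h1 h2; rewrite !ler_norml => /andP[? ?].
by move=> *; apply/andP; split; nra.
Qed.

Lemma asymp_linear_perturb (R : realType) (f g : nat -> R) (delta : R) :
  asymp_linear f delta ->
  (forall eps, 0 < eps -> exists B, forall N, `|g N - f N| <= eps * N%:R + B) ->
  asymp_linear g delta.
Proof.
move=> Hf Hg eps e0; have e2 : 0 < eps / 2 by rewrite divr_gt0.
have [B HB] := Hf _ e2; have [C HC] := Hg _ e2.
exists (B + C) => N; rewrite (_ : _ - _ = (g N - f N) + (f N - N%:R * delta)); last by ring.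
apply: le_trans (ler_normD _ _) _; apply: le_trans (lerD (HC N) (HB N)) _.
by rewrite [leRHS](_ : _ = eps / 2 * N%:R + C + (eps / 2 * N%:R + B)) //; field.
Qed.

Lemma asymp_linear_cvg (R : realType) (f : nat -> R) (delta : R) :
  asymp_linear f delta -> f N / N%:R @[N --> \oo] --> delta.
Proof.
move=> Hf; apply/cvgrPdist_le => eps e0.
have e2 : 0 < eps / 2 by rewrite divr_gt0.
have [B HB] := Hf _ e2; near=> N.
have N0 : 0 < N%:R :> R by rewrite ltr0n; near: N; exact: nbhs_infty_gt.
have NB : B / (eps / 2) <= N%:R by near: N; exact: nbhs_infty_ger.
rewrite distrC -(ler_pM2r N0) -[X in _ * X <= _](gtr0_norm N0) -normrM mulrBl.
rewrite divfK ?gt_eqF// (mulrC delta); apply: le_trans (HB N) _.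
by move: NB; rewrite ler_pdivrMr//; nra.
Unshelve. all: by end_near. Qed.

(** Passing from a real x to its integer part moves the main term by at most |delta|, which is
    o(x). *)
Lemma asymp_linear_has_density (R : realType) (S : set nat) (delta : R) :
  asymp_linear (fun N => (count (mem S) (iota 1 N))%:R) delta ->
  has_density S delta.
Proof.
move=> Hf; apply/cvgrPdist_le => eps e0.
have e2 : 0 < eps / 2 by rewrite divr_gt0.
have [B HB] := Hf _ e2; near=> x.
have x0 : 0 < x by near: x; apply: nbhs_pinfty_gt; rewrite num_real.
have xB : (`|B| + `|delta|) / (eps / 2) <= x by near: x; apply: nbhs_pinfty_ge; rewrite num_real.
have := HB (Num.truncn x); set c := (count _ _)%:R.
have /andP[] := truncn_itv (ltW x0); rewrite -natr1; set n := (_%:R) => nx xn Hc.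
rewrite distrC -(ler_pM2r x0) -[X in _ * X <= _](gtr0_norm x0) -normrM mulrBl.
rewrite divfK ?gt_eqF//.
move: xB; rewrite ler_pdivrMr// => xB.
have H3 : `|n * delta - delta * x| <= `|delta|.
  rewrite (mulrC n) -mulrBr normrM -[leRHS]mulr1 ler_wpM2l//.
  by rewrite ler_norml; apply/andP; split; lra.
rewrite (_ : c - _ = (c - n * delta) + (n * delta - delta * x)); last by ring.
apply: le_trans (ler_normD _ _) _; apply: le_trans (lerD Hc H3) _.
have := ler_norm B; nra.
Unshelve. all: by end_near. Qed.



(** * Sparsity of the t with ell(t) small compared to t *)

Section AbstractSieve.
Variables (R : realType) (L : nat -> option nat).
Hypothesis L_dvd : forall t e, (0 < t)%N -> L t = Some e -> (0 < e)%N /\ (t %| e)%N.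
Hypothesis L_prime : forall p t e, prime p -> (0 < t)%N -> (p %| t)%N ->
  L t = Some e -> exists2 e', L p = Some e' & (e' %| e)%N.
Hypothesis L_tail : forall eps : R, 0 < eps -> exists y, forall z,
  \sum_(y <= p < z | prime p) recip R (L p) <= eps.

(** For t > 0 this is L(t) <= K t, since t divides L(t). Naming the quotient c allows a union bound
    over c <= K. *)
Definition small_multiple (K t : nat) : bool :=
  has (fun c => L t == Some (c * t)%N) (iota 1 K).

(** e | c t amounts to e / gcd(e, c) | t, and gcd(e, c) <= c. *)
Lemma count_dvdn_mul (c e N : nat) : (0 < c)%N -> (0 < e)%N ->
  (count (fun t => e %| c * t)%N (iota 1 N))%:R <= c%:R * N%:R * e%:R^-1 :> R.
Proof.
move=> c0 e0; set d := (e %/ gcdn e c)%N.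
have g0 : (0 < gcdn e c)%N by rewrite gcdn_gt0 e0.
have d0 : (0 < d)%N by rewrite divn_gt0// dvdn_leq// dvdn_gcdl.
have ed : (e = d * gcdn e c)%N by rewrite divnK// dvdn_gcdl.
rewrite (@eq_count _ _ (dvdn d)); last first.
  move=> t /=; rewrite {1}ed -[X in (_ %| X * t)%N](divnK (dvdn_gcdr e c)).
  rewrite mulnAC dvdn_pmul2r// Gauss_dvdr//.
  by rewrite /coprime -(eqn_pmul2r g0) muln_gcdl mul1n !divnK ?dvdn_gcdl ?dvdn_gcdr.
rewrite count_dvdn ler_pdivlMr ?ltr0n// -!natrM ler_nat.
apply: (@leq_trans (N * gcdn e c)).
  by rewrite [X in (_ * X <= _)%N]ed mulnA leq_mul// leq_trunc_div.
by rewrite mulnC leq_mul// dvdn_leq// dvdn_gcdr.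
Qed.

(* If L t = c t and the prime p divides t, then t lies in the sparse set of
   those t with L p | c t; and few t avoid all the primes of [y, z). *)
Lemma count_small_multiple (K : nat) (eps : R) : 0 < eps ->
  exists B, forall N,
    (count (small_multiple K) (iota 1 N))%:R <= eps * N%:R + B.
Proof.
move=> e0; have e2 : 0 < eps / 2 by rewrite divr_gt0.
(* The sum over c <= K costs a factor K^2; the successor keeps the divisor positive. *)
have [y Hy] := L_tail (divr_gt0 e2 (ltr0Sn R (K * K))).
have [z Hz] := totient_prod_primes_small y e2.
move: Hz; set M := (\prod_(_ <= _ < _ | _) _)%N => Hz.
have M0 : (0 < M)%N by rewrite prodn_cond_gt0// => p /prime_gt0.
exists M%:R => N; set s := [seq p <- index_iota y z | prime p].
have pt (t : nat) : (0 < t)%N -> (small_multiple K t)%:R <= (coprime M t)%:R +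
    \sum_(p <- s) \sum_(c <- iota 1 K)
      (divides_opt (L p) (c * t))%:R :> R.
  move=> t0; have [/hasP[c cK /eqP Lt]|_] := boolP (small_multiple K t); last first.
    by rewrite addr_ge0// !sumr_ge0// => p _; rewrite sumr_ge0.
  have [_|] := boolP (coprime M t).
    by rewrite lerDl !sumr_ge0// => p _; rewrite sumr_ge0.
  rewrite coprime_has_primes// negbK => /hasP[p pt pM].
  have [pp _ pdt] : [/\ prime p, (0 < t)%N & (p %| t)%N].
    by move: pt; rewrite mem_primes => /and3P.
  have ps : p \in s.
    move: pM; rewrite /= mem_primes => /and3P[_ _].
    rewrite /M Euclid_dvd_prod// big_has_cond => /hasP[q qyz /andP[pq]].
    by rewrite dvdn_prime2// => /eqP ->; rewrite mem_filter pq.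
  have [e' Lp e'e] := L_prime pp t0 pdt Lt.
  rewrite add0r (big_rem p)//= (big_rem c)//= Lp /= e'e.
  by rewrite -addrA lerDl addr_ge0 ?sumr_ge0// => i _; rewrite sumr_ge0.
rewrite count_natr; apply: le_trans (_ : \sum_(1 <= t < N.+1) ((coprime M t)%:R +
    \sum_(p <- s) \sum_(c <- iota 1 K)
      (divides_opt (L p) (c * t))%:R) <= _).
  rewrite big_nat [leRHS]big_nat; apply: ler_sum => t /andP[t0 _]; exact: pt.
rewrite big_split/= -count_natr.
(* Coprimality to M has period M and density phi(M) / M <= eps / 2. *)
have h1 : (count (coprime M) (iota 1 N))%:R <= eps / 2 * N%:R + M%:R :> R.
  have HP n : coprime M (M + n) = coprime M n by rewrite /coprime gcdnDl.
  have := periodic_density R N M0 HP.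
  rewrite count_coprime ler_norml => /andP[_]; rewrite lerBlDl => /le_trans; apply.
  rewrite lerD2r mulrC ler_wpM2r// ler_pdivrMr ?ltr0n//.
have h2 : \sum_(1 <= t < N.+1) \sum_(p <- s) \sum_(c <- iota 1 K)
      (divides_opt (L p) (c * t))%:R <= eps / 2 * N%:R :> R.
  rewrite exchange_big /=.
  apply: (@le_trans _ _ (\sum_(p <- s) (K * K)%:R * N%:R * recip R (L p))).
    rewrite big_seq [leRHS]big_seq; apply: ler_sum => p; rewrite mem_filter => /andP[pp _].
    rewrite exchange_big /=.
    apply: (@le_trans _ _ (\sum_(c <- iota 1 K) K%:R * N%:R * recip R (L p))); last first.
      rewrite big_const_seq count_predT size_iota iter_addr_0 natrM.
      by rewrite -[X in X <= _]mulr_natl !mulrA.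
    rewrite big_seq [leRHS]big_seq; apply: ler_sum => c.
    rewrite mem_iota add1n ltnS => /andP[c0 cK].
    have <- : (count (fun t => divides_opt (L p) (c * t)) (iota 1 N))%:R =
      \sum_(1 <= t < N.+1) (divides_opt (L p) (c * t))%:R :> R by exact: count_natr.
    case Lp : (L p) => [e|] /=; last first.
      by rewrite (eq_count (a2 := pred0))// count_pred0 mulr0.
    have [ep _] := L_dvd (prime_gt0 pp) Lp.
    apply: le_trans (count_dvdn_mul _ c0 ep) _.
    by rewrite ler_wpM2r// ler_wpM2r// ler_nat.
  rewrite -mulr_sumr big_filter mulrAC ler_wpM2r//.
  apply: le_trans (ler_wpM2l _ (Hy z)) _ => //.
  rewrite mulrCA ger_pMr// ler_pdivrMr ?ltr0n// mul1r ler_nat.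
  exact: leqnSn.
by rewrite [leRHS](_ : _ = eps / 2 * N%:R + M%:R + eps / 2 * N%:R) ?lerD//; field.
Qed.

(** Three kinds of t, each costing about d N: those with t <= d N, the sparse ones with L(t) <= K t,
    and the rest, whose terms N / L(t) are each at most d. *)
Lemma sum_min_recip (eps : R) : 0 < eps ->
  exists B, forall N,
    \sum_(1 <= t < N.+1) Num.min 1 (N%:R * recip R (L t)) <= eps * N%:R + B.
Proof.
move=> e0; pose d := eps / 3; have d0 : 0 < d by rewrite divr_gt0.
(* K > d^-2 is what the third kind requires: L(t) > K t and t > d N give N / L(t) <= 1 / (K d) <=
   d. *)
pose K := (Num.truncn (d ^- 2)).+1.
have [B HB] := count_small_multiple K d0; exists B => N.
have pt t : (0 < t)%N -> Num.min 1 (N%:R * recip R (L t)) <=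
    (t%:R <= d * N%:R)%R%:R + (small_multiple K t)%:R + d :> R.
  move=> t0; have [td|td] := lerP t%:R (d * N%:R).
    by rewrite ge_min; apply/orP; left; rewrite -addrA lerDl addr_ge0// ltW.
  have [_|/hasPn H] := boolP (small_multiple K t).
    by rewrite ge_min; apply/orP; left; rewrite add0r lerDl ltW.
  rewrite ge_min; apply/orP; right; rewrite !add0r.
  case Lt : (L t) => [e|] /=; last by rewrite mulr0 ltW.
  have [ep /dvdnP[c ec]] := L_dvd t0 Lt.
  have cK : (K < c)%N.
    rewrite ltnNge; apply/negP => cK; have ci : c \in iota 1 K.
      rewrite mem_iota add1n ltnS cK andbT lt0n; apply/eqP => c0.
      by rewrite ec c0 in ep.
    by have := H c ci; rewrite Lt ec eqxx.
  have Kc : d ^- 2 <= c%:R.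
    apply/ltW/(lt_trans (truncnS_gt _)); by rewrite ltr_nat.
  rewrite ler_pdivrMr ?ltr0n// ec natrM.
  have : 1 <= c%:R * d ^+ 2 by rewrite -ler_pdivrMr ?exprn_gt0// mul1r.
  have t0' : 0 < t%:R :> R by rewrite ltr0n.
  have N0 : 0 <= N%:R :> R by [].
  set x := c%:R; set y := t%:R => hc.
  have h : N%:R * 1 <= N%:R * (x * d ^+ 2) by rewrite ler_wpM2l.
  rewrite mulr1 in h; apply: le_trans h _.
  rewrite (_ : _ * _ = d * N%:R * (d * x)); last by ring.
  rewrite (_ : d * (x * y) = y * (d * x)); last by ring.
  by rewrite ler_wpM2r ?mulr_ge0// ltW.
apply: (@le_trans _ _ (\sum_(1 <= t < N.+1) ((t%:R <= d * N%:R)%R%:R + (small_multiple K t)%:R + d))).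
  by rewrite big_nat [leRHS]big_nat; apply: ler_sum => t /andP[t0 _]; exact: pt.
rewrite !big_split/= -!count_natr.
rewrite sumr_const_nat subSS subn0 -mulr_natr.
have h1 := @count_natr_le R (d * N%:R) N (mulr_ge0 (ltW d0) (ler0n _ _)).
rewrite (_ : eps = d + d + d); last by rewrite /d; field.
have := HB N; lra.
Qed.
End AbstractSieve.



(** * Density of a sifted set *)

Section SieveDensity.
(** [L] stands for [ell F] and [Lk t] for [ell F (t * k)]; [Pd] selects both the sifting primes and
    the indices t of the Moebius sum. *)
Variables (R : realType) (L Lk : nat -> option nat) (Pd : pred nat) (S : set nat).
Hypothesis L_dvd : forall t e, (0 < t)%N -> L t = Some e -> (0 < e)%N /\ (t %| e)%N.
Hypothesis L_prime : forall p t e, prime p -> (0 < t)%N -> (p %| t)%N ->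
  L t = Some e -> exists2 e', L p = Some e' & (e' %| e)%N.
Hypothesis L_tail : forall eps : R, 0 < eps -> exists y, forall z,
  \sum_(y <= p < z | prime p) recip R (L p) <= eps.
Hypothesis Lk_dvd : forall t e, (0 < t)%N -> Lk t = Some e -> (0 < e)%N /\ (t %| e)%N.
Hypothesis Lk_le : forall t, (0 < t)%N -> recip R (Lk t) <= recip R (L t).
Hypothesis S_spec : forall n, (0 < n)%N -> S n <-> divides_opt (Lk 1) n /\
  (forall p, prime p -> Pd p -> ~~ divides_opt (Lk p) n).
Hypothesis S_moebius : forall n N, (0 < n <= N)%N ->
  (n \in S)%:R = \sum_(1 <= t < N.+1 | Pd t && divides_opt (Lk t) n) moebius t :> int.

Lemma Lk_bounds t N : (0 < t)%N ->
  0 <= N%:R * recip R (Lk t) - (count (divides_opt (Lk t)) (iota 1 N))%:R <=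
    Num.min 1 (N%:R * recip R (Lk t)).
Proof.
move=> t0; apply: count_divides_opt; case Lt: (Lk t) => [e|] //.
by have [] := Lk_dvd t0 Lt.
Qed.

(** Sifting by the primes below y leaves the periodic set [Sy]. In [1, N] it differs from S only at
    n divisible by some Lk(p) with p >= y, hence at no more than N times a tail of the sum of
    1/L(p). *)
Lemma sieve_density : exists delta : R,
  asymp_linear (fun N => (count (mem S) (iota 1 N))%:R) delta.
Proof.
apply: asymp_linear_complete => eps e0.
have [y Hy] := L_tail e0.
pose Sy n := divides_opt (Lk 1) n &&
  all (fun p => prime p && Pd p ==> ~~ divides_opt (Lk p) n) (iota 0 y).
(* An infinite [Lk t] gives a condition that is constantly false, of period 1. *)
pose per t := odflt 1%N (Lk t).
(* The head 1 accounts for the condition on [Lk 1], the rest for the sifting primes. *)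
pose T := (\prod_(t <- 1%N :: iota 0 y | (0 < t)%N) per t)%N.
have T0 : (0 < T)%N.
  apply: prodn_cond_gt0 => t t0; rewrite /per; case Lt : (Lk t) => [e|] //=.
  by have [] := Lk_dvd t0 Lt.
have perT t n : t \in 1%N :: iota 0 y -> (0 < t)%N ->
    divides_opt (Lk t) (T + n) = divides_opt (Lk t) n.
  move=> ts t0; case Lt : (Lk t) => [e|] //=; rewrite dvdn_addr//.
  rewrite /T (big_rem t)//= t0; apply: dvdn_mulr.
  by rewrite /per Lt.
have SyT n : Sy (T + n)%N = Sy n.
  rewrite /Sy perT ?mem_head//; congr andb; apply: eq_in_all => p pin.
  case: (boolP (prime p)) => //= pp.
  by rewrite perT ?inE ?pin ?orbT// prime_gt0.
exists ((count Sy (iota 1 T))%:R / T%:R), T%:R => N.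
have h1 := periodic_density R N T0 SyT.
have h2 : `|(count (mem S) (iota 1 N))%:R - (count Sy (iota 1 N))%:R| <= eps * N%:R :> R.
  rewrite !count_natr -sumrB; apply: le_trans (ler_norm_sum _ _ _) _.
  (* The range of p may stop at N because p | Lk(p) | n <= N. *)
  apply: (@le_trans _ _ (\sum_(1 <= n < N.+1) \sum_(y <= p < N.+1 | prime p)
      (divides_opt (Lk p) n)%:R)).
    rewrite big_nat [leRHS]big_nat; apply: ler_sum => n /andP[n0 nN] /=.
    have [nS|nS] := boolP (n \in S).
      move: nS; rewrite inE => /(S_spec n0)[d1 dp].
      rewrite (_ : Sy n = true) ?subrr ?normr0 ?sumr_ge0//.
      rewrite /Sy d1; apply/allP => p _; apply/implyP => /andP[pp Pp]; exact: dp.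
    have [Syn|_] := boolP (Sy n); last by rewrite subrr normr0 sumr_ge0.
    rewrite sub0r normrN normr1.
    suff [p [pp dp py]] : exists p, [/\ prime p, divides_opt (Lk p) n & (y <= p)%N].
      rewrite big_mkcond (big_rem p)/= ?pp ?dp ?lerDl ?sumr_ge0//.
        by move=> q _; case: ifP.
      rewrite mem_index_iota py ltnS; move: dp; case Lp : (Lk p) => [e|] //= en.
      have [_ pe] := Lk_dvd (prime_gt0 pp) Lp.
      by rewrite (leq_trans (dvdn_leq n0 (dvdn_trans pe en))).
    apply: contrapT => /forallNP H; move: nS; rewrite notin_setE; apply.
    move: Syn => /andP[d1 dp]; apply/(S_spec n0); split=> // p pp Pp.
    apply/negP => dpn; have [py|yp] := ltnP p y; last by apply: (H p).
    have := allP dp p; rewrite mem_iota add0n py /= pp Pp /= dpn.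
    by move=> /(_ isT).
  rewrite exchange_big /= mulrC.
  apply: (@le_trans _ _ (N%:R * \sum_(y <= p < N.+1 | prime p) recip R (L p))).
    rewrite mulr_sumr; apply: ler_sum => p pp; rewrite -count_natr.
    have /andP[+ _] := Lk_bounds N (prime_gt0 pp); rewrite subr_ge0 => /le_trans; apply.
    by rewrite ler_wpM2l// Lk_le// prime_gt0.
  by rewrite ler_wpM2l.
set c := (count (mem S) _)%:R in h2 *.
rewrite [X in `|X|](_ : _ = (c - (count Sy (iota 1 N))%:R) + ((count Sy (iota 1 N))%:R -
  N%:R * ((count Sy (iota 1 T))%:R / T%:R))); last by ring.
by apply: le_trans (ler_normD _ _) _; rewrite lerD.
Qed.

(** The density is known to exist first. The exact Moebius count of S in [1, N] then differs from N
    times the partial sum by o(N), which forces the partial sums to the same limit without absolute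
    convergence. *)
Lemma sieve_density_moebius : exists delta : R,
  (\sum_(1 <= t < N | Pd t) (moebius t)%:~R * recip R (Lk t) @[N --> \oo] --> delta)
  /\ has_density S delta.
Proof.
have [delta Hd] := sieve_density; exists delta; split; last exact: asymp_linear_has_density.
pose s N : R := \sum_(1 <= t < N.+1 | Pd t) (moebius t)%:~R * recip R (Lk t).
have cntE N : (count (mem S) (iota 1 N))%:R = \sum_(1 <= t < N.+1 | Pd t)
    (moebius t)%:~R * (count (divides_opt (Lk t)) (iota 1 N))%:R :> R.
  rewrite count_natr.
  under [RHS]eq_bigr do rewrite count_natr mulr_sumr.
  rewrite [RHS]exchange_big /= big_nat [RHS]big_nat; apply: eq_bigr => n /andP[n0 nN].
  have /(congr1 (fun x : int => x%:~R : R)) : _ = _ := S_moebius (introT andP (conj n0 nN)).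
  rewrite rmorph_nat rmorph_sum/= => ->.
  rewrite big_mkcondr; apply: eq_bigr => t _.
  by case: ifP; rewrite ?mulr1 ?mulr0.
have Hs : asymp_linear (fun N => N%:R * s N) delta.
  apply: asymp_linear_perturb Hd _ => eps e0.
  have [B HB] := sum_min_recip L_dvd L_prime L_tail e0; exists B => N.
  apply: le_trans (HB N); rewrite cntE mulr_sumr -sumrB.
  under eq_bigr do rewrite mulrCA -mulrBr.
  apply: le_trans (ler_norm_sum _ _ _) _.
  rewrite big_mkcond big_nat [leRHS]big_nat; apply: ler_sum => t /andP[t0 _].
  have min_ge0 : 0 <= Num.min 1 (N%:R * recip R (L t)).
    by rewrite le_min ler01 mulr_ge0// recip_ge0.
  case: ifP => // _; have /andP[h1 h2] := Lk_bounds N t0.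
  rewrite normrM (ger0_norm h1) -[leRHS]mul1r; apply: ler_pM => //.
    by rewrite -intr_norm -[1]/(1%:~R) ler_int normr_moebius.
  apply: le_trans h2 _; rewrite le_min !ge_min lexx /=.
  by rewrite ler_wpM2l ?orbT// Lk_le.
have Hs1 := asymp_linear_cvg Hs.
(* [s N] includes t = N, whereas the series is stated with t < N. *)
rewrite -(cvg_shiftS (fun N => \sum_(1 <= t < N | Pd t) (moebius t)%:~R * recip R (Lk t))).
apply: cvg_trans Hs1; apply: near_eq_cvg; near=> N.
rewrite mulrAC divff ?mul1r// pnatr_eq0 -lt0n; near: N; exact: nbhs_infty_gt.
Unshelve. all: by end_near. Qed.
End SieveDensity.



(** * Rank of apparition *)

Section Rank.
Variable F : {poly int}.
Local Notation a := (orbit0 F).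

Lemma orbit0D (n m : nat) : a (n + m) = iter n (horner F) (a m).
Proof. by rewrite /orbit0 iterD. Qed.

Lemma dvdz_horner_sub (d x y : int) : (d %| x - y)%Z -> (d %| F.[x] - F.[y])%Z.
Proof.
move=> dxy; rewrite !horner_coef -sumrB; apply: rpred_sum => i _.
by rewrite -mulrBr subrXX mulrCA; apply: dvdz_mulr.
Qed.

Lemma dvdz_iter_horner_sub (d x y : int) (n : nat) : (d %| x - y)%Z ->
  (d %| iter n (horner F) x - iter n (horner F) y)%Z.
Proof. by move=> dxy; elim: n => //= n; exact: dvdz_horner_sub. Qed.

Lemma dvdz_orbit0D (d : int) (r n : nat) : (d %| a r)%Z ->
  (d %| a (n + r))%Z = (d %| a n)%Z.
Proof.
move=> dr; have : (d %| a (n + r) - a n)%Z.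
  by rewrite orbit0D -{2}[n]addn0 orbit0D; apply: dvdz_iter_horner_sub; rewrite subr0.
by move=> h; rewrite -[a (n + r)](subrK (a n)) rpredDl.
Qed.

Lemma dvdz_orbit0_mul (d : int) (r q n : nat) : (d %| a r)%Z ->
  (d %| a (q * r + n))%Z = (d %| a n)%Z.
Proof.
move=> dr; elim: q => [|q IHq]; first by rewrite mul0n.
rewrite mulSn -addnA addnC. by rewrite dvdz_orbit0D.
Qed.

(** Modulo m the orbit is back at a_0 = 0 at time r, so it has period r from the start; minimality
    of r excludes a zero at a nonzero remainder of n modulo r. *)
Lemma rank_Some (m r : nat) : rank F m = Some r ->
  (0 < r)%N /\ forall n, (m%:Z %| a n)%Z = (r %| n)%N.
Proof.
rewrite /rank; case: pselect => // exr; case: ex_minnP => s /andP[s0 ms] mins [<-].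
split=> // n; rewrite {1}(divn_eq n s) dvdz_orbit0_mul// /dvdn.
have := ltn_pmod n s0; case: (n %% s)%N => [|t] ts; first exact: dvdz0.
by apply/negP => mt; have := mins t.+1 mt; rewrite leqNgt ts.
Qed.

Lemma rank_None (m n : nat) : rank F m = None -> (0 < n)%N -> ~~ (m%:Z %| a n)%Z.
Proof.
rewrite /rank; case: pselect => // nex _ n0; apply/negP => mn.
by apply: nex; exists n; rewrite n0.
Qed.

(** Positivity of n matters: a_0 = 0 is divisible even by an m of infinite rank. *)
Lemma divides_ell (m n : nat) : (0 < n)%N ->
  divides_opt (ell F m) n = (m %| n)%N && (m%:Z %| a n)%Z.
Proof.
move=> n0; rewrite /ell; case E : (rank F m) => [r|] /=.
  by have [_ ->] := rank_Some E; rewrite dvdn_lcm.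
by rewrite (negbTE (rank_None E n0)) andbF.
Qed.

Lemma ell_Some (m e : nat) : (0 < m)%N -> ell F m = Some e ->
  (0 < e)%N /\ (m %| e)%N.
Proof.
move=> m0; rewrite /ell; case E : (rank F m) => [r|] //= [<-].
by have [r0 _] := rank_Some E; rewrite lcmn_gt0 m0 r0 dvdn_lcml.
Qed.

(** Test at the index e itself: m divides e and a_e, hence so does d. *)
Lemma ell_dvd (d m e : nat) : (0 < m)%N -> (d %| m)%N -> ell F m = Some e ->
  exists2 e', ell F d = Some e' & (e' %| e)%N.
Proof.
move=> m0 dm Em; have [e0 _] := ell_Some m0 Em.
have := divides_ell m e0; rewrite Em /= dvdnn => /esym/andP[me mae].
have := divides_ell d e0; rewrite (dvdn_trans dm me) (dvdz_trans _ mae)//.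
by case: (ell F d) => // e' /= e'e; exists e'.
Qed.

Lemma recip_ell_le (R : realType) (d m : nat) : (0 < m)%N -> (d %| m)%N ->
  recip R (ell F m) <= recip R (ell F d).
Proof.
move=> m0 dm; case E : (ell F m) => [e|] /=; last exact: recip_ge0.
have [e' -> e'e] := ell_dvd m0 dm E; have [e0 _] := ell_Some m0 E.
by rewrite /= lef_pV2 ?posrE ?ltr0n ?ler_nat ?(dvdn_leq e0)// (dvdn_gt0 e0).
Qed.

(** Pigeonhole: two of a_0, ..., a_m agree modulo m, say at i < j, and then r divides j - i <= m. *)
Lemma rank_le (m r : nat) : (0 < m)%N -> rank F m = Some r -> (r <= m)%N.
Proof.
case: m => // m _ Er; have [r0 Hr] := rank_Some Er.
pose f (i : 'I_m.+2) : 'I_m.+1 := inord `|(a i %% m.+1%:Z)%Z|.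
have : ~~ injectiveb f.
  by apply/negP => /injectiveP /leq_card; rewrite !card_ord ltnn.
move=> /injectivePn[i0 [j0 ij0 fij]].
wlog : i0 j0 ij0 fij / (i0 < j0)%N.
  move=> H; have [ij|ji|/val_inj ij] := ltngtP i0 j0; first exact: (H i0 j0).
    by apply: (H j0 i0) => //; rewrite eq_sym.
  by rewrite ij eqxx in ij0.
case: i0 j0 ij0 fij => [i ilt] [j jlt] _ fij /= ij.
have mod_lt x : (`|(x %% m.+1%:Z)%Z| < m.+1)%N.
  by rewrite -ltz_nat gez0_abs ?modz_ge0// ltz_pmod.
have : (m.+1%:Z %| a j - a i)%Z.
  move: (congr1 val fij); rewrite /f /= !inordK// => E.
  rewrite -eqz_mod_dvd eq_sym; apply/eqP.
  by rewrite -[LHS]gez0_abs ?modz_ge0// E gez0_abs ?modz_ge0.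
(* Advancing both indices by i r - i makes the first one a multiple of r, where the orbit vanishes
   modulo m; the second is i r + (j - i). *)
move=> /(@dvdz_iter_horner_sub _ _ _ (i * r - i)%N).
rewrite -!orbit0D subnK ?leq_pmulr// => h.
have : (m.+1%:Z %| a (i * r - i + j))%Z.
  rewrite -[a (i * r - i + j)](subrK (a (i * r)%N)) rpredDl//.
  by rewrite -/(_ %| _)%Z Hr dvdn_mull.
rewrite Hr; have -> : (i * r - i + j = i * r + (j - i))%N.
  by have := leq_pmulr i r0; lia.
rewrite dvdn_addr ?dvdn_mull// => /dvdn_leq; rewrite subn_gt0 => /(_ ij); lia.
Qed.

(** A return to 0 would make the orbit periodic, hence bounded by the sum of |a_i| over a period. *)
Lemma orbit0_neq0 : wandering0 F -> forall n, (0 < n)%N -> a n != 0.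
Proof.
move=> W r r0; apply/negP => /eqP ar.
have per q s : a (q * r + s)%N = a s.
  elim: q => [|q IHq]; first by rewrite mul0n.
  by rewrite mulSn -addnA addnC orbit0D ar.
have [n] := W (\sum_(i < r) `|a i|).
rewrite (divn_eq n r) per (bigD1 (Ordinal (ltn_pmod n r0)))//= gtrDl.
by rewrite ltNge sumr_ge0.
Qed.

Lemma orbit0_growth : exists B : nat, forall n, (`|a n| <= 2 ^ (B ^ n))%N.
Proof.
(* A bounds the coefficients and D exceeds the degree, so |F(x)| <= A y^D for |x| <= y = 2^E. As E >
   0, A <= 2^(A E), and the exponent grows by the factor A + D. *)
pose A := (\sum_(i < size F) `|(F`_i)%R|)%N; pose D := (size F).+1.
exists (A + D)%N => n; elim: n => [|n IHn]; first by rewrite expn0 expn1.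
set E := ((A + D) ^ n)%N in IHn.
have E0 : (0 < E)%N by rewrite expn_gt0 addnS.
have : (`|F.[a n]| <= A * (2 ^ E) ^ D)%N.
  rewrite horner_coef; apply: leq_trans (_ : \sum_(i < size F) `|(F`_i * a n ^+ i)%R| <= _)%N.
    apply: (@big_ind2 _ _ (fun (x : int) (y : nat) => `|x| <= y)%N) => //= x1 y1 x2 y2 h1 h2.
    have := leqD_dist x1 0 (- x2); rewrite !(opprK, subr0, add0r) => /leq_trans; apply.
    exact: leq_add.
  rewrite /A big_distrl /=; apply: leq_sum => i _.
  rewrite abszM leq_mul// abszX.
  apply: leq_trans (_ : (2 ^ E) ^ i <= _)%N; last by rewrite leq_pexp2l ?expn_gt0// /D leqW// ltnW.
  by case: (posnP i) => [->|i0] //; rewrite leq_exp2r.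
rewrite /= => /leq_trans; apply.
apply: (@leq_trans (2 ^ (A * E) * (2 ^ E) ^ D)).
  rewrite leq_mul2r (leq_trans (ltnW (ltn_expl A (ltnSn 1))))  ?orbT// leq_exp2l// leq_pmulr//.
by rewrite -expnM -expnD [X in (_ <= 2 ^ X)%N]expnS -/E mulnDl (mulnC E D).
Qed.
End Rank.



(** * Primes of small rank and convergence of the sum of 1/ell(p) *)

Lemma prod_orbit0_growth (F : {poly int}) (B : nat) :
  (forall n, (`|orbit0 F n| <= 2 ^ (B ^ n))%N) ->
  forall r, (\prod_(1 <= i < r.+1) `|orbit0 F i| <= 2 ^ (B.+1 ^ r))%N.
Proof.
move=> HB; elim=> [|r IHr]; first by rewrite big_geq// expn0 expn1.
rewrite big_nat_recr//; apply: leq_trans (leq_mul IHr (HB _)) _.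
rewrite -expnD leq_exp2l// [in leqRHS]expnS mulSn leq_add2l expnS leq_mul2l.
by apply/orP; right; case: (posnP r) => [->|r0] //; rewrite leq_exp2r.
Qed.

(** These primes, all at least 2, divide the product a_1 ... a_r, which is nonzero because 0 is
    wandering. *)
Lemma size_small_rank (F : {poly int}) (B r : nat) (s : seq nat) :
  wandering0 F -> (forall n, (`|orbit0 F n| <= 2 ^ (B ^ n))%N) ->
  uniq s -> all prime s ->
  all (fun p => if rank F p is Some q then (q <= r)%N else false) s ->
  (size s <= B.+1 ^ r)%N.
Proof.
move=> W HB us ps rs; rewrite -(@leq_exp2l 2)//.
apply: leq_trans (prod_orbit0_growth HB r).
apply: expn_size_primes => //.
- rewrite big_nat_cond prodn_cond_gt0// => i /andP[/andP[i0 _] _].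
  by rewrite absz_gt0 orbit0_neq0.
- by apply/allP => p /(allP ps); exact: prime_gt1.
- apply/allP => p pin; have := allP rs p pin; case E : (rank F p) => [q|] // qr.
  have [q0 Hq] := rank_Some E.
  rewrite (big_rem q)/=; last by rewrite mem_index_iota q0 ltnS.
  by apply: dvdn_mulr; have := Hq q; rewrite dvdnn dvdzE.
Qed.

(** The rank r is at most p, and r = p would give p | a_p; so p does not divide r and the lcm is p
    r. *)
Lemma recip_ell_regular (R : realType) (F : {poly int}) (p r : nat) :
  prime p -> ~~ (p%:Z %| orbit0 F p)%Z -> rank F p = Some r ->
  recip R (ell F p) = (p%:R * r%:R)^-1.
Proof.
move=> pp pap Er; have [r0 Hr] := rank_Some Er.
have rp := rank_le (prime_gt0 pp) Er.
rewrite Hr in pap.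
have co : coprime p r.
  rewrite prime_coprime//; apply/negP => /(dvdn_leq r0) pr.
  by move: pap; rewrite (_ : r = p) ?dvdnn//; apply/eqP; rewrite eqn_leq rp pr.
have [lcmE] : lcmn p r = (p * r)%N by rewrite -muln_lcm_gcd (eqP co) muln1.
by rewrite /ell Er /= lcmE natrM.
Qed.

(** Serves to bound 2^(j/2) / 2^j by 8 / j^2 in a dyadic block. *)
Lemma sqr_le_exp2_half (j : nat) : (j ^ 2 * 2 ^ j./2 <= 8 * 2 ^ j)%N.
Proof.
have sq m : (m ^ 2 <= 2 * 2 ^ m)%N.
  elim: m => [|[|[|[|m]]] IHm] //; rewrite (expnS 2).
  have : (m.+4 ^ 2 <= 2 * m.+3 ^ 2)%N.
    by rewrite -[m.+4]addn4 -[m.+3]addn3 !sqrnD; lia.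
  by move=> /leq_trans; apply; rewrite leq_mul2l.
rewrite -{3}(odd_double_half j) -addnn addnA expnD mulnA leq_mul2r; apply/orP; right.
apply: leq_trans (_ : 4 * (odd j + j./2) ^ 2 <= _)%N.
  rewrite -[4%N]/(2 ^ 2)%N -expnMn leq_exp2r//.
  by rewrite -{1}(odd_double_half j) -muln2; case: odd; lia.
by apply: leq_trans (leq_mul (leqnn 4) (sq _)) _; rewrite mulnA.
Qed.

Section TailSum.
Variables (R : realType) (F : {poly int}).
Hypothesis W : wandering0 F.

Let regular p := prime p && ~~ (p%:Z %| orbit0 F p)%Z.

(** Split at rank r0. At most 2^(j/2) primes have rank <= r0, each contributing at most 2^-j: this
    gives the 8. The others contribute at most 2 M / (2^j j) each, and by Chebyshev's bound there
    are at most 2^(j+1) / j of them: this gives the 4 M. *)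
Lemma dyadic_block : exists C : R, 0 <= C /\ forall j, (0 < j)%N ->
  \sum_((2 ^ j).+1 <= p < (2 ^ j.+1).+1 | regular p) recip R (ell F p)
    <= C / j%:R ^+ 2.
Proof.
have [B HB] := orbit0_growth F.
pose M := B.+1; exists (8 + 4 * M%:R); split; first by rewrite addr_ge0 ?mulr_ge0.
(* This r0 makes M^r0 <= (2^M)^r0 <= 2^(j/2), while a rank above r0 is still at least j / (2 M). *)
move=> j j0; pose r0 := (j %/ (2 * M))%N.
pose small p := if rank F p is Some q then (q <= r0)%N else false.
set s := index_iota _ _.
have j0' : 0 < j%:R :> R by rewrite ltr0n.
have q0 : 0 < 2 ^+ j :> R by rewrite exprn_gt0.
have M2 : (0 < 2 * M)%N by rewrite muln_gt0.
have KM : 0 <= (2 * M)%:R / (2 ^+ j * j%:R) :> R.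
  by apply: divr_ge0 => //; rewrite mulr_ge0// ltW.
have pt p : p \in s -> regular p -> recip R (ell F p) <=
    (regular p && small p)%:R * (2 ^+ j)^-1 + (prime p)%:R * ((2 * M)%:R / (2 ^+ j * j%:R)).
  rewrite mem_index_iota => /andP[lp _] rp; have /andP[pp pap] := rp.
  rewrite rp pp mul1r /small /=.
  case E : (rank F p) => [r|]; last first.
    by rewrite /ell E /= mul0r add0r.
  rewrite (recip_ell_regular R pp pap E); have [rp0 _] := rank_Some E.
  have p0 : 0 < p%:R :> R by rewrite ltr0n prime_gt0.
  have p2 : 2 ^+ j <= p%:R :> R by rewrite -natrX ler_nat ltnW.
  have r1 : 1 <= r%:R :> R by rewrite ler1n.
  have r0' : 0 < r%:R :> R by rewrite ltr0n.
  case: leqP => [_|rr0].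
    rewrite mul1r -[leLHS]addr0 lerD//.
    rewrite lef_pV2 ?posrE ?mulr_gt0//; apply: le_trans p2 _.
    by rewrite ler_peMr// ltW.
  rewrite mul0r add0r.
  have jr : (j <= r * (2 * M))%N.
    by apply: ltnW; rewrite -ltn_divLR.
  rewrite ler_pdivlMr ?mulr_gt0// mulrC ler_pdivrMr ?mulr_gt0//.
  have jr' : j%:R <= r%:R * (2 * M)%:R :> R by rewrite -natrM ler_nat.
  apply: le_trans (ler_pM _ _ p2 jr') _; rewrite ?exprn_ge0//.
  by rewrite le_eqVlt; apply/orP; left; apply/eqP; ring.
rewrite big_seq_cond; apply: le_trans (_ : \sum_(p <- s | (p \in s) && regular p)
   ((regular p && small p)%:R * (2 ^+ j)^-1 + (prime p)%:R * ((2 * M)%:R / (2 ^+ j * j%:R)))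
   <= _).
  by apply: ler_sum => p /andP[ps rp]; exact: pt.
rewrite -big_seq_cond big_mkcond.
apply: le_trans (_ : \sum_(p <- s)
   ((regular p && small p)%:R * (2 ^+ j)^-1 + (prime p)%:R * ((2 * M)%:R / (2 ^+ j * j%:R)))
   <= _).
  have if_le (b : bool) (x : R) : 0 <= x -> (if b then x else 0) <= x by case: b.
  apply: ler_sum => p _; apply: if_le.
  by rewrite addr_ge0 ?mulr_ge0// invr_ge0 ltW.
rewrite big_split/= -!mulr_suml.
have cntE (P : pred nat) : \sum_(p <- s) (P p)%:R = (count P s)%:R :> R.
  by rewrite -sum1_count natr_sum [RHS]big_mkcond; apply: eq_bigr => p _; case: (P p).
rewrite !cntE.
have c1 : (count (fun p => regular p && small p) s <= 2 ^ j./2)%N.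
  rewrite -size_filter.
  apply: leq_trans (size_small_rank (B := B) (r := r0) W HB _ _ _) _.
  - by rewrite filter_uniq// iota_uniq.
  - by apply/allP => p; rewrite mem_filter => /andP[/andP[/andP[]]].
  - by apply/allP => p; rewrite mem_filter => /andP[/andP[]].
  apply: leq_trans (_ : (2 ^ M) ^ r0 <= _)%N.
    by case: (posnP r0) => [->|?] //; rewrite leq_exp2r// ltnW// ltn_expl.
  rewrite -expnM leq_exp2l// -divn2 leq_divRL// /r0 mulnC mulnA.
  by rewrite mulnC leq_trunc_div.
have c2 := chebyshev_dyadic j; rewrite -/s in c2.
rewrite mulrDl lerD//.
  rewrite ler_pdivrMr// mulrAC ler_pdivlMr ?exprn_gt0//.
  apply: le_trans (_ : (2 ^ j./2)%:R * j%:R ^+ 2 <= _).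
    by rewrite ler_wpM2r ?exprn_ge0// ler_nat.
  by rewrite -!natrX -!natrM ler_nat mulnC sqr_le_exp2_half.
rewrite mulrA ler_pdivrMr ?mulr_gt0// mulrAC ler_pdivlMr ?exprn_gt0//.
rewrite expr2.
have : j%:R * (count prime s)%:R <= 2 * 2 ^+ j :> R.
  by rewrite -natrX -!natrM ler_nat -expnS.
have M0 : 0 <= M%:R :> R by [].
rewrite natrM.
set x := j%:R; set c := (count _ _)%:R => xc.
rewrite (_ : c * _ * _ = 2 * M%:R * x * (x * c)); last by ring.
rewrite (_ : 4 * _ * _ = 2 * M%:R * x * (2 * 2 ^+ j)); last by ring.
by rewrite ler_wpM2l ?mulr_ge0// ltW.
Qed.
End TailSum.



Lemma bounded_sum_tail (R : realType) (P : pred nat) (f : nat -> R) (K : R) :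
  (forall n, 0 <= f n) -> (forall n, \sum_(0 <= i < n | P i) f i <= K) ->
  forall eps, 0 < eps -> exists y, forall z, \sum_(y <= i < z | P i) f i <= eps.
Proof.
move=> f0 HK eps e0; pose A := range (fun n => \sum_(0 <= i < n | P i) f i).
have supA : has_sup A.
  split; first by exists (\sum_(0 <= i < 0 | P i) f i), 0%N.
  by exists K => _ [n _ <-].
have [_ [y _ <-] hy] := sup_adherent e0 supA; exists y => z.
have [zy|/ltnW yz] := leqP z y; first by rewrite big_geq// ltW.
have : \sum_(0 <= i < z | P i) f i <= sup A by apply: ub_le_sup; [exact: supA.2|exists z].
rewrite (@big_cat_nat _ _ _ y)//= => hz.
rewrite -(lerD2l (\sum_(0 <= i < y | P i) f i)); apply: le_trans hz _.
by rewrite -lerBlDr ltW.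
Qed.

Lemma nice_bound (R : realType) (F : {poly int}) : nice R F ->
  exists K : R, forall n,
    \sum_(0 <= p < n | prime p && (p%:Z %| orbit0 F p)%Z) p%:R^-1 <= K.
Proof.
rewrite /nice; set s := (\sum_(0 <= p <oo | _) _)%E => sfin.
have s0 : (0 <= s)%E by apply: nneseries_ge0 => p _ _; rewrite lee_fin.
exists (fine s) => n; rewrite -lee_fin fineK ?ge0_fin_numE//.
rewrite -sumEFin; apply: nneseries_lim_ge => p _ _; by rewrite lee_fin.
Qed.

(** Telescoping through 1/j^2 <= 2 (1/j - 1/(j+1)). The sum starts at 3 because the block j = 1 is
    (2, 4]. *)
Lemma sum_inv_sqr_blocks (R : realType) (f : nat -> R) (P : pred nat) (C : R) :
  0 <= C -> (forall j, (0 < j)%N ->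
    \sum_((2 ^ j).+1 <= p < (2 ^ j.+1).+1 | P p) f p <= C / j%:R ^+ 2) ->
  forall j, \sum_(3 <= p < (2 ^ j.+1).+1 | P p) f p <= 2 * C * (1 - j.+1%:R^-1).
Proof.
move=> C0 H; elim=> [|j IHj]; first by rewrite big_geq// invr1 subrr mulr0.
rewrite (@big_cat_nat _ _ _ (2 ^ j.+1).+1)//=; first last.
- by rewrite ltnS leq_exp2l.
- by rewrite ltnS (leq_exp2l 1).
apply: le_trans (lerD IHj (H _ (ltn0Sn j))) _.
have j0 : 0 < j.+1%:R :> R by [].
have j1 : 1 <= j.+1%:R :> R by rewrite ler1n.
rewrite -[j.+2%:R]natr1; set x := j.+1%:R in j0 j1 *.
rewrite -subr_ge0 [X in _ <= X](_ : _ = C * ((x - 1) / (x ^+ 2 * (x + 1)))); last first.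
  by field; rewrite !gt_eqF// addr_gt0.
rewrite mulr_ge0// divr_ge0 ?subr_ge0// mulr_ge0 ?exprn_ge0 ?addr_ge0// ltW.
Qed.

(** The primes p | a_p are covered by niceness through 1/ell(p) <= 1/p, the others by dyadic blocks,
    with [T] for those below 3. *)
Lemma recip_ell_summable (R : realType) (F : {poly int}) :
  wandering0 F -> nice R F ->
  exists K : R, forall n, \sum_(0 <= p < n | prime p) recip R (ell F p) <= K.
Proof.
move=> W /nice_bound[K0 HK0]; have [C [C0 HC]] := @dyadic_block R F W.
pose reg p := prime p && ~~ (p%:Z %| orbit0 F p)%Z.
pose T := \sum_(0 <= p < 3 | reg p) recip R (ell F p).
exists (K0 + (T + 2 * C)) => n.
rewrite (bigID (fun p => (p%:Z %| orbit0 F p)%Z))/=; apply: lerD.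
  apply: le_trans (HK0 n); apply: ler_sum => p /andP[pp _].
  case E : (ell F p) => [e|] //=.
  have [e0 pe] := ell_Some (prime_gt0 pp) E.
  by rewrite lef_pV2 ?posrE ?ltr0n ?(prime_gt0 pp)// ler_nat dvdn_leq.
have nn : (n <= (2 ^ n.+1).+1)%N.
  by rewrite ltnW// ltnS ltnW// (leq_trans (ltn_expl n (ltnSn 1)))// leq_exp2l.
apply: (@le_trans _ _ (\sum_(0 <= p < (2 ^ n.+1).+1 | reg p) recip R (ell F p))).
  rewrite [leRHS](@big_cat_nat _ _ _ n)//= lerDl.
  by apply: sumr_ge0 => p _; exact: recip_ge0.
rewrite (@big_cat_nat _ _ _ 3)//=; last by rewrite ltnS (leq_exp2l 1).
rewrite lerD2l; apply: le_trans (sum_inv_sqr_blocks C0 HC n) _.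
by rewrite -[leRHS]mulr1 ler_wpM2l ?mulr_ge0// gerBl invr_ge0.
Qed.

(** * The gcd sets as sifted sets *)

Lemma gcdGa_X (F : {poly int}) (n : nat) : gcdGa F 'X n = (gcdn n `|orbit0 F n|)%:Z.
Proof. by rewrite /gcdGa hornerX. Qed.

Lemma divides_ell_gcd (F : {poly int}) (m n : nat) : (0 < n)%N ->
  divides_opt (ell F m) n = (m %| gcdn n `|orbit0 F n|)%N.
Proof. by move=> n0; rewrite divides_ell// dvdn_gcd dvdzE. Qed.

(* [part m] stands for the largest divisor of m whose divisors all satisfy Pd. *)
Lemma sieve_moebius_sum (F : {poly int}) (k : nat) (Pd : pred nat)
    (part : nat -> nat) (S : set nat) (n N : nat) :
  (0 < k)%N ->
  (forall m, (0 < m)%N -> (0 < part m <= m)%N) ->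
  (forall m t, (0 < m)%N -> (0 < t)%N -> (t %| part m)%N = Pd t && (t %| m)%N) ->
  (forall n, (0 < n)%N -> S n <-> divides_opt (ell F (1 * k)) n /\
    (forall p, prime p -> Pd p -> ~~ divides_opt (ell F (p * k)) n)) ->
  (0 < n <= N)%N -> (n \in S)%:R =
    \sum_(1 <= t < N.+1 | Pd t && divides_opt (ell F (t * k)) n) moebius t :> int.
Proof.
move=> k0 Hpart Hdvd HS /andP[n0 nN]; have {}HS := HS n n0.
set g := gcdn n `|orbit0 F n|.
have g0 : (0 < g)%N by rewrite gcdn_gt0 n0.
have gN : (g <= N)%N by rewrite (leq_trans _ nN)// dvdn_leq// dvdn_gcdl.
have Hd t : divides_opt (ell F (t * k)) n = (t * k %| g)%N by exact: divides_ell_gcd.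
(* If k does not divide g, both sides vanish. Otherwise g = m k, and t k | g becomes t | m. *)
have [/dvdnP[m gmk]|kg] := boolP (k %| g)%N; last first.
  rewrite big1 => [|t /andP[_]]; last first.
    by rewrite Hd => /(dvdn_trans (dvdn_mull t (dvdnn k))); rewrite (negbTE kg).
  have [|//] := boolP (n \in S); rewrite inE => /HS[+ _].
  by rewrite Hd mul1n (negbTE kg).
have m0 : (0 < m)%N by move: g0; rewrite gmk muln_gt0 => /andP[].
have {}Hd t : divides_opt (ell F (t * k)) n = (t %| m)%N.
  by rewrite Hd gmk dvdn_pmul2r.
have /andP[pm0 pm] := Hpart m m0.
have pmN : (part m <= N)%N.
  by rewrite (leq_trans pm)// (leq_trans _ gN)// gmk leq_pmulr.
have -> : \sum_(1 <= t < N.+1 | Pd t && divides_opt (ell F (t * k)) n) moebius t =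
    \sum_(1 <= t < N.+1 | (t %| part m)%N) moebius t.
  rewrite [LHS]big_mkcond [RHS]big_mkcond [LHS]big_nat [RHS]big_nat.
  by apply: eq_bigr => t /andP[t0 _]; rewrite Hd Hdvd.
rewrite sum_moebius_dvd ?pm0//; congr (nat_of_bool _)%:R.
(* n lies in S exactly when [part m] is 1: its prime factors are the primes of [Pd] that divide
   m. *)
apply/idP/eqP => [|pm1].
  rewrite inE => /HS[_ Hp]; apply/eqP/negPn/negP => pm1.
  have pm2 : (1 < part m)%N by rewrite ltn_neqAle eq_sym pm1.
  have pp := pdiv_prime pm2.
  have := pdiv_dvd (part m); rewrite Hdvd ?pdiv_gt0// => /andP[Pp].
  by rewrite -Hd (negbTE (Hp _ pp Pp)).
rewrite inE; apply/HS; split; first by rewrite Hd dvd1n.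
move=> p pp Pp; rewrite Hd; apply/negP => pm'.
have := Hdvd m p m0 (prime_gt0 pp); rewrite Pp pm' pm1 /= dvdn1.
by move/eqP => p1; rewrite p1 in pp.
Qed.

Lemma sieve_density_ell (R : realType) (F : {poly int}) (k : nat) (Pd : pred nat)
    (S : set nat) :
  wandering0 F -> nice R F -> (0 < k)%N ->
  (forall n, (0 < n)%N -> S n <-> divides_opt (ell F (1 * k)) n /\
    (forall p, prime p -> Pd p -> ~~ divides_opt (ell F (p * k)) n)) ->
  (exists2 part : nat -> nat, forall m, (0 < m)%N -> (0 < part m <= m)%N &
    forall m t, (0 < m)%N -> (0 < t)%N -> (t %| part m)%N = Pd t && (t %| m)%N) ->
  exists delta : R,
    (\sum_(1 <= t < N | Pd t) (moebius t)%:~R * recip R (ell F (t * k)) @[N --> \oo]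
      --> delta) /\ has_density S delta.
Proof.
move=> W Nc k0 HS [part Hpart Hdvd].
have [K HK] := recip_ell_summable W Nc.
apply: (@sieve_density_moebius R (ell F) (fun t => ell F (t * k)) Pd S) => //.
- by move=> t e; exact: ell_Some.
- by move=> p t e _ t0 pt; exact: ell_dvd.
- apply: bounded_sum_tail HK => n; exact: recip_ge0.
- move=> t e t0 /ell_Some[]; first by rewrite muln_gt0 t0.
  by move=> e0 te; split=> //; exact: dvdn_trans (dvdn_mulr _ (dvdnn t)) te.
- by move=> t t0; apply: recip_ell_le; rewrite ?muln_gt0 ?t0// dvdn_mulr.
- by move=> n N; exact: sieve_moebius_sum Hpart Hdvd HS.
Qed.

Theorem theorem1p2 (R : realType) (F : {poly int}) (k : nat)
    (F_lead : 0 < lead_coef F) (F_deg : (2 < size F)%N)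
    (F_wand : wandering0 F) (F_nice : nice R F) (k_gt0 : (0 < k)%N) :
  (exists delta : R,
     (\sum_(1 <= d < N | coprime d k)
        (moebius d)%:~R * recip R (ell F (d * k)) @[N --> \oo] --> delta)
     /\ has_density (setB F 'X k) delta) /\
  (exists delta : R,
     (\sum_(1 <= t < N)
        (moebius t)%:~R * recip R (ell F (t * k)) @[N --> \oo] --> delta)
     /\ has_density (setA F 'X k) delta).
Proof.
split.
(* Only primes p not dividing k are sifted out; for these, p | g and k | g together mean p k | g. *)
- apply: (@sieve_density_ell R F k (fun d => coprime d k)) => // [n n0|].
    rewrite /setB /= gcdGa_X divides_ell_gcd// mul1n.
    set g := gcdn n _; split=> [[_ kg Hp]|[kg Hp]].
      split=> [|p pp cop]; first by move: kg; rewrite dvdzE.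
      rewrite divides_ell_gcd//; apply/negP => pkg.
      have := Hp p pp; rewrite dvdzE /= (dvdn_trans (dvdn_mulr k (dvdnn p)) pkg).
      by move: cop; rewrite prime_coprime// => /negP h /(_ isT).
    split=> // p pp; rewrite dvdzE /= => pg; apply/negPn/negP => pk.
    have cop : coprime p k by rewrite prime_coprime.
    by have := Hp p pp cop; rewrite divides_ell_gcd// Gauss_dvd// pg kg.
  (* The largest divisor of m coprime to k. *)
  exists (fun m => m`_(\pi(k)^'))%N => [m m0|m t m0 t0].
    by rewrite part_gt0 dvdn_leq// dvdn_part.
  rewrite coprime_sym coprime_pi'//; apply/idP/andP => [tm|[tk tm]].
    split; last exact: dvdn_trans tm (dvdn_part _ _).
    exact: pnat_dvd tm (part_pnat _ _).
  by rewrite -(part_pnat_id tk); exact: partn_dvd.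
(* Every prime is sifted out: if g = m k with m > 1, a prime p | m gives p k | g. *)
- apply: (@sieve_density_ell R F k predT) => // [n n0|]; last first.
    by exists id => // m m0; rewrite m0 /=.
  rewrite /setA /= gcdGa_X divides_ell_gcd// mul1n.
  split=> [[_ [gk]]|[/dvdnP[m gmk] Hp]].
    rewrite gk; split=> // p pp _; rewrite divides_ell_gcd// gk.
    apply/negP => /(dvdn_leq k_gt0); rewrite leqNgt => /negP[].
    by rewrite ltn_Pmull// prime_gt1.
  split=> //; rewrite gmk; suff -> : m = 1%N by rewrite mul1n.
  have g0 : (0 < gcdn n `|orbit0 F n|)%N by rewrite gcdn_gt0 n0.
  have m0 : (0 < m)%N by move: g0; rewrite gmk muln_gt0 => /andP[].
  apply/eqP/negPn/negP => m1.
  have pp : prime (pdiv m) by rewrite pdiv_prime// ltn_neqAle eq_sym m1.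
  by have := Hp _ pp isT; rewrite divides_ell_gcd// gmk dvdn_pmul2r// pdiv_dvd.
Qed.
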